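(* Let $n \geq 1$ be an integer and $0 \leq \epsilon < 1$ with $\epsilon/(1-\epsilon)^2 \leq \frac{1}{64 n}$. Let $X_1, Z_1, \ldots, X_n, Z_n$ be Hermitian matrices (all acting on the same finite-dimensional complex Hilbert space $\mathcal H$), each having all eigenvalues in $[-1, -1+\epsilon] \cup [1-\epsilon, 1]$, and satisfying $\|\{X_j, Z_j\}\| \leq \epsilon$ for all $j$ and $\|[S_i, T_j]\| \leq \epsilon$ for all $i \neq j$ and all $S, T \in \{X, Z\}$. Then there exist reflections $X_1', Z_1', \ldots, X_n', Z_n'$ on $\mathcal H$ with $\{X_j', Z_j'\} = 0$ for all $j$, and with $[S_i', T_j'] = 0$ and $$\|S_j' - S_j\| \leq \frac{4 n \epsilon}{(1-\epsilon)^2} + \epsilon$$ for all $i \neq j$ and all $S, T \in \{X, Z\}$ (the last bound holding for every $j \in \{1,\ldots,n\}$).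
   Context: A reflection is a Hermitian operator that squares to the identity. $[A,B] = AB - BA$, $\{A,B\} = AB + BA$, and $\|\cdot\|$ is the operator norm. ''$S_i$ for $S \in \{X,Z\}$'' means $X_i$ or $Z_i$ (the letter $S$ is replaced by $X$ or $Z$). *)

(* Defs.v *)
From mathcomp Require Export all_boot all_order all_algebra.
From mathcomp Require Export complex.
From mathcomp Require Export classical_sets reals.

Set Implicit Arguments.
Unset Strict Implicit.
Unset Printing Implicit Defensive.

Import Order.TTheory GRing.Theory Num.Theory.

Local Open Scope ring_scope.
Local Open Scope complex_scope.
Local Open Scope classical_set_scope.

Variant letter := X | Z.

Section OperatorsOnCd.
Variables (R : realType) (d : nat).
Implicit Types (A B : 'M[R[i]]_d) (v : 'cV[R[i]]_d).

Definition commutator A B : 'M[R[i]]_d := A *m B - B *m A.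

Definition anticommutator A B : 'M[R[i]]_d := A *m B + B *m A.

Definition l2norm v : R := Num.sqrt (\sum_(k < d) (Normc.normc (v k 0)) ^+ 2).

(* The unit ball rather than the unit sphere keeps the set nonempty for d = 0;
   the set is bounded, so the total function sup is a genuine supremum. *)
Definition opnorm A : R := sup [set l2norm (A *m v) | v in [set v | l2norm v <= 1]].

Definition reflection A : Prop := A \is hermsymmx /\ A *m A = 1%:M.

(* The order of R[i] only compares numbers with equal imaginary parts, so each
   eigenvalue is required to be real and to lie in one of the two intervals. *)
Definition spectrum_near_pm1 (eps : R) A : Prop :=
  forall a : R[i], eigenvalue A a ->
    (-1 <= a <= -1 + eps%:C) \/ (1 - eps%:C <= a <= 1).

End OperatorsOnCd.

(* Main.v *)
Require Import Defs.
From mathcomp Require Import boolp.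
From mathcomp Require Import ring lra.

Set Implicit Arguments.
Unset Strict Implicit.
Unset Printing Implicit Defensive.

Import Order.TTheory GRing.Theory Num.Theory.

Local Open Scope ring_scope.
Local Open Scope complex_scope.

(* Process the 2n operators one at a time.  Rounding [A] to its sign [s] enlarges
   (anti)commutators by a factor of at most 1/(1 - eps): with a = sA >= 1 - eps
   and C = sB -+ Bs, the operator aC + Ca is twice a compression of AB -+ BA, and
   testing it on an extremal eigenvector of C gives
   2 (1 - eps) |C| <= |aC + Ca|.

   Given reflections whose (anti)commutators have norm at most e, and a pivot s
   among them, replace every T by (T +- sTs)/2, which relates to s exactly, and
   round again.  The discarded part T- has norm at most e/2.  Conjugation by s
   grades the operators, so T- affects the pairwise relations and the identity
   T^2 = 1 only through products of two discarded parts: e grows to at most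
   e + e^2, and each operator moves by at most e.  Exact relations persist.  Over
   2n steps the error stays below twice its initial value e0 = eps/(1 - eps)^2,
   because n e0 <= 1/64, so the total displacement is at most 4 n e0. *)

Local Open Scope sesquilinear_scope.

(** * Algebra of the conjugate transpose *)

Section Adjoint.
Variable C : numClosedFieldType.

Lemma adjM m n p (A : 'M[C]_(m, n)) (B : 'M[C]_(n, p)) :
  (A *m B)^t* = B^t* *m A^t*.
Proof. by rewrite trmx_mul map_mxM. Qed.

Lemma adjD m n (A B : 'M[C]_(m, n)) : (A + B)^t* = A^t* + B^t*.
Proof. by rewrite linearD map_mxD. Qed.

Lemma adjZ m n a (A : 'M[C]_(m, n)) :
  (a *: A)^t* = (a^*)%R *: A^t*.
Proof. by rewrite linearZ map_mxZ. Qed.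

End Adjoint.

(** * Euclidean norm and operator bounds *)

Section L2norm.
Variables (R : realType) (d : nat).
Implicit Types (u v w : 'cV[R[i]]_d) (A B : 'M[R[i]]_d).

Definition inner u v : R[i] := (u^t* *m v) 0 0.

Lemma inner_dotmx u v : inner u v = dotmx v^T u^T.
Proof.
rewrite dotmxE /inner trmxK !mxE; apply: eq_bigr => k _.
by rewrite !mxE mulrC.
Qed.

Lemma innerDl v w (x : 'cV[R[i]]_d) : inner (v + w) x = inner v x + inner w x.
Proof. by rewrite /inner adjD mulmxDl mxE. Qed.

Lemma inner_adj A u v : inner u (A *m v) = inner (A^t* *m u) v.
Proof. by rewrite /inner adjM trmxCK mulmxA. Qed.

Lemma normC_normc (x : R[i]) : `|x| = (Normc.normc x)%:C.
Proof. by []. Qed.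

Lemma normc_ge0 (x : R[i]) : 0 <= Normc.normc x.
Proof. by case: x => a b; exact: sqrtr_ge0. Qed.

Lemma normc_ge0_id (a : R) : 0 <= a -> Normc.normc a%:C = a.
Proof. by move=> a0; apply: complexI; rewrite -normC_normc ger0_norm // ler0c. Qed.

Lemma l2norm_ge0 v : 0 <= l2norm v.
Proof. exact: sqrtr_ge0. Qed.

Lemma l2norm_inner v : (l2norm v ^+ 2)%:C = inner v v.
Proof.
rewrite sqr_sqrtr; last by apply: sumr_ge0 => k _; exact: sqr_ge0.
rewrite rmorph_sum /inner mxE; apply: eq_bigr => k _.
by rewrite !mxE mulrC -normCK normC_normc rmorphXn.
Qed.

Lemma sqrtC_inner v : sqrtC (inner v v) = (l2norm v)%:C.
Proof. by rewrite -l2norm_inner rmorphXn sqrCK // ler0c l2norm_ge0. Qed.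

Lemma inner_bound u v : Normc.normc (inner u v) <= l2norm u * l2norm v.
Proof.
rewrite -lecR -normC_normc rmorphM /= -!sqrtC_inner !inner_dotmx mulrC.
exact: (CauchySchwarz_sqrt (@dotmx R[i] d) _ _).1.
Qed.

Lemma l2normD u v : l2norm (u + v) <= l2norm u + l2norm v.
Proof.
rewrite -lecR rmorphD /= -!sqrtC_inner !inner_dotmx linearD.
exact: (triangle_lerif (@dotmx R[i] d) _ _).1.
Qed.

Lemma l2normZ a v : l2norm (a *: v) = Normc.normc a * l2norm v.
Proof.
rewrite /l2norm -[X in X * _]ger0_norm ?normc_ge0 // -sqrtr_sqr -sqrtrM ?sqr_ge0 //.
rewrite mulr_sumr; congr Num.sqrt; apply: eq_bigr => k _.
by rewrite mxE Normc.normcM exprMn.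
Qed.

Lemma l2norm0 : l2norm (0 : 'cV[R[i]]_d) = 0.
Proof. by rewrite -(scale0r 0) l2normZ Normc.normc0 mul0r. Qed.

Lemma l2norm_eq0 v : l2norm v = 0 -> v = 0.
Proof.
move=> v0; apply: trmx_inj; rewrite trmx0; apply/eqP.
rewrite -(dnorm_eq0 (@dotmx R[i] d)) -[X in X == 0]/(dotmx v^T v^T).
by rewrite -inner_dotmx -l2norm_inner v0 expr0n.
Qed.

Lemma l2norm_isometry A v : A^t* *m A = 1%:M -> l2norm (A *m v) = l2norm v.
Proof.
move=> AA1; apply/eqP; rewrite -(@eqrXn2 _ 2) ?l2norm_ge0 //.
by rewrite -(inj_eq (@complexI R)) !l2norm_inner inner_adj mulmxA AA1 mul1mx.
Qed.

(** Stands in for [opnorm A <= e]: with no supremum involved, sums, products and scalings are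
    bounded vector by vector. [opnorm] itself returns only when the hypotheses are read and the
    conclusion is stated. *)
Definition opbound (e : R) A := forall v, l2norm (A *m v) <= e * l2norm v.

Lemma opbound_le e e' A : e <= e' -> opbound e A -> opbound e' A.
Proof.
by move=> ee' Ae v; apply: le_trans (Ae v) _; rewrite ler_wpM2r ?l2norm_ge0.
Qed.

Lemma opboundD e e' A B : opbound e A -> opbound e' B -> opbound (e + e') (A + B).
Proof.
move=> Ae Be v; rewrite mulmxDl mulrDl.
by apply: le_trans (l2normD _ _) _; apply: lerD.
Qed.

Lemma opboundZ a e A : opbound e A -> opbound (Normc.normc a * e) (a *: A).
Proof.
by move=> Ae v; rewrite -scalemxAl l2normZ -mulrA ler_wpM2l ?normc_ge0.
Qed.

Lemma opboundN e A : opbound e A -> opbound e (- A).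
Proof.
move=> Ae v; rewrite mulNmx -scaleN1r l2normZ normcN Normc.normc1 mul1r.
exact: Ae.
Qed.

Lemma opboundM e e' A B : 0 <= e ->
  opbound e A -> opbound e' B -> opbound (e * e') (A *m B).
Proof.
move=> e0 Ae Be v; rewrite -mulmxA; apply: le_trans (Ae _) _.
by rewrite -mulrA ler_wpM2l.
Qed.

Lemma opbound_eq0 A : opbound 0 A -> A = 0.
Proof.
move=> A0; apply/matrixP => i j; rewrite !mxE.
have -> : A i j = (A *m (delta_mx j 0 : 'cV_d)) i 0 by rewrite -colE mxE.
rewrite (_ : A *m _ = 0) ?mxE //; apply: l2norm_eq0; apply/eqP.
by rewrite eq_le l2norm_ge0 andbT -[leRHS](mul0r (l2norm (delta_mx j 0))).
Qed.

Lemma opbound0 : opbound 0 0.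
Proof. by move=> v; rewrite mul0mx l2norm0 mul0r. Qed.

Lemma opbound_opnorm e A : 0 <= e -> opbound e A -> opnorm A <= e.
Proof.
move=> e0 Ae; apply: ge_sup.
  by exists (l2norm (A *m 0)); exists 0 => //=; rewrite l2norm0.
move=> _ [v /= v1 <-]; apply: le_trans (Ae v) _.
by rewrite -[leRHS]mulr1 ler_wpM2l.
Qed.

(** The a priori bound [K] makes the set under [sup] bounded, so that [sup] really dominates its
    elements; a nonzero vector is then rescaled to norm 1. *)
Lemma opnorm_opbound K e A : 0 <= K -> opbound K A -> opnorm A <= e -> opbound e A.
Proof.
move=> K0 AK Ae v; have [/l2norm_eq0 ->|v0] := eqVneq (l2norm v) 0.
  by rewrite mulmx0 l2norm0 mulr0.
have v_gt0 : 0 < l2norm v by rewrite lt_neqAle eq_sym v0 l2norm_ge0.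
have nV : Normc.normc (l2norm v)^-1%:C = (l2norm v)^-1.
  by rewrite normc_ge0_id // invr_ge0 ltW.
rewrite -ler_pdivrMr // mulrC -[X in X * _]nV -l2normZ scalemxAr.
apply: le_trans Ae; apply: ub_le_sup.
  exists K => _ [w /= w1 <-]; apply: le_trans (AK w) _.
  by rewrite -[leRHS]mulr1 ler_wpM2l.
by exists ((l2norm v)^-1%:C *: v) => //=; rewrite l2normZ nV mulVf.
Qed.

End L2norm.

(** * Spectral decomposition of normal matrices and a Sylvester-type inequality *)

Section Spectral.
Variables (R : realType) (d : nat).
Implicit Types (v w : 'cV[R[i]]_d) (A B P : 'M[R[i]]_d).

Lemma opbound_diag e (D : 'rV[R[i]]_d) : 0 <= e ->
  (forall i, Normc.normc (D 0 i) <= e) -> opbound e (diag_mx D).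
Proof.
move=> e0 De v; rewrite -ler_sqr ?nnegrE ?mulr_ge0 ?l2norm_ge0 // exprMn.
rewrite !sqr_sqrtr; try by apply: sumr_ge0 => k _; exact: sqr_ge0.
rewrite mulr_sumr; apply: ler_sum => k _.
rewrite mul_diag_mx mxE Normc.normcM exprMn ler_wpM2r ?sqr_ge0 //.
by rewrite ler_sqr ?nnegrE ?normc_ge0.
Qed.

Lemma spectralmx_adjK A : (spectralmx A)^t* *m spectralmx A = 1%:M.
Proof. by rewrite -{1}[X in X *m _]mul1mx mulmxKtV // spectral_unitarymx. Qed.

Lemma spectralmxK_adj A : spectralmx A *m (spectralmx A)^t* = 1%:M.
Proof. exact/unitarymxP/spectral_unitarymx. Qed.

Lemma normal_spectralE A : A \is normalmx ->
  A = (spectralmx A)^t* *m diag_mx (spectral_diag A) *m spectralmx A.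
Proof.
move=> /orthomx_spectralP {1}->.
by rewrite invmx_unitary ?spectral_unitarymx.
Qed.

Lemma opbound_conj e A P : P^t* *m P = 1%:M -> P *m P^t* = 1%:M ->
  opbound e A -> opbound e (P^t* *m A *m P).
Proof.
move=> P1 P2 Ae v; rewrite -!mulmxA l2norm_isometry ?trmxCK //.
by rewrite -[l2norm v](l2norm_isometry v P1).
Qed.

Lemma opbound_normal e A : A \is normalmx -> 0 <= e ->
  (forall i, Normc.normc (spectral_diag A 0 i) <= e) -> opbound e A.
Proof.
move=> An e0 De; rewrite (normal_spectralE An).
apply: opbound_conj; rewrite ?spectralmx_adjK ?spectralmxK_adj //.
exact: opbound_diag.
Qed.

Definition spectral_vector A i : 'cV_d := (spectralmx A)^t* *m delta_mx i 0.

Lemma l2norm_spectral_vector A i : l2norm (spectral_vector A i) = 1.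
Proof.
rewrite l2norm_isometry ?trmxCK ?spectralmxK_adj //.
rewrite /l2norm (bigD1 i) //= big1 => [|k ki].
  by rewrite mxE !eqxx Normc.normc1 expr1n addr0 sqrtr1.
by rewrite mxE (negPf ki) Normc.normc0 expr0n.
Qed.

Lemma mul_spectral_vector A i : A \is normalmx ->
  A *m spectral_vector A i = spectral_diag A 0 i *: spectral_vector A i.
Proof.
move=> An; rewrite {1}(normal_spectralE An) /spectral_vector -!mulmxA.
rewrite (mulmxA (spectralmx A)) spectralmxK_adj mul1mx scalemxAr.
congr (_ *m _); apply/matrixP => k l.
rewrite mul_diag_mx !mxE; by case: eqP => [->|] //=; rewrite !mulr0.
Qed.

Lemma mul_adj_spectral_vector A i : A \is normalmx ->
  (spectral_vector A i)^t* *m A = spectral_diag A 0 i *: (spectral_vector A i)^t*.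
Proof.
move=> An; rewrite {2}(normal_spectralE An) /spectral_vector adjM trmxCK !mulmxA.
rewrite -(mulmxA _ (spectralmx A)) spectralmxK_adj mulmx1 scalemxAl.
congr (_ *m _); apply/matrixP => k l.
rewrite mul_mx_diag !mxE [_ == 0]eq_sym.
by case: (l =P i) => [->|_] /=; rewrite ?rmorph0 ?mul0r ?mulr0 // mulrC.
Qed.

Lemma eigenvalue_spectral_diag A i : A \is normalmx ->
  eigenvalue A (spectral_diag A 0 i).
Proof.
(* [eigenvalue] speaks of row vectors, so the witness is the adjoint of the column eigenvector. *)
move=> An; apply/eigenvalueP; exists ((spectral_vector A i)^t*).
  exact: mul_adj_spectral_vector.
apply/eqP => v0; have /eqP := l2norm_spectral_vector A i.
suff -> : spectral_vector A i = 0 by rewrite l2norm0 eq_sym oner_eq0.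
by rewrite -[LHS]trmxCK v0 trmx0 map_mx0.
Qed.

Lemma hermP A : reflect (A^t* = A) (A \is hermsymmx).
Proof.
by rewrite qualifE /= expr0 scale1r eq_sym; apply: eqP.
Qed.

(** If [w] is a unit eigenvector of the normal matrix [B] with eigenvalue [b], testing on [w] gives
    [2 * b * inner w (A *m w)], of modulus at least [2 * m * |b|]. So every eigenvalue of [B] has
    modulus at most [e / (2 * m)], and normality turns this into a norm bound. *)
Lemma sylvester_bound (m e : R) A B : 0 < m -> 0 <= e -> B \is normalmx ->
  (forall v, (m * l2norm v ^+ 2)%:C <= inner v (A *m v)) ->
  opbound e (A *m B + B *m A) -> opbound (e / (2 * m)) B.
Proof.
move=> m0 e0 Bn Am Me; apply: opbound_normal => // [|i].
  by rewrite divr_ge0 // mulr_ge0 // ltW.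
set b := spectral_diag B 0 i; pose w := spectral_vector B i.
have w1 : l2norm w = 1 := l2norm_spectral_vector B i.
have wM : inner w ((A *m B + B *m A) *m w) = 2 * b * inner w (A *m w).
  rewrite /inner mulmxDl mulmxDr -!mulmxA mul_spectral_vector // -/b -/w.
  rewrite (mulmxA (w^t*) B) mul_adj_spectral_vector // -/b -/w.
  by rewrite -scalemxAl -!scalemxAr !mxE; ring.
have := Am w; rewrite w1 expr1n mulr1 => Aw.
have : Normc.normc (2 * b * inner w (A *m w)) <= e.
  rewrite -wM; apply: le_trans (inner_bound _ _) _.
  by rewrite w1 mul1r -[e]mulr1 -w1.
rewrite ler_pdivlMr ?mulr_gt0 //; apply: le_trans.
have n2 : Normc.normc (2 : R[i]) = 2.
  by apply: complexI; rewrite -normC_normc ger0_norm ?ler0n // rmorph_nat.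
have nA : m <= Normc.normc (inner w (A *m w)).
  have m0C : 0 <= m%:C by rewrite ler0c ltW.
  by rewrite -lecR -normC_normc ger0_norm // (le_trans m0C Aw).
by rewrite !Normc.normcM n2 -mulrA mulrCA ler_wpM2l // ler_wpM2l ?normc_ge0.
Qed.

End Spectral.

(** * Rounding Hermitian matrices to reflections *)

Section Rounding.
Variables (R : realType) (d : nat).
Implicit Types (v w : 'cV[R[i]]_d) (A B C M s P : 'M[R[i]]_d) (x y : 'rV[R[i]]_d).

Lemma conj_sign (b : bool) : (((-1) ^+ b : R[i])^*)%R = (-1) ^+ b.
Proof. exact: rmorph_sign. Qed.

Lemma normc_sign (b : bool) : Normc.normc ((-1) ^+ b : R[i]) = 1.
Proof. by apply: complexI; rewrite -normC_normc normr_sign. Qed.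

(** The commutator for [b = false] and the anticommutator for [b = true], so that one argument
    serves both. *)
Definition rel (b : bool) A B : 'M[R[i]]_d := A *m B - (-1) ^+ b *: (B *m A).

Lemma rel_sym b A B : rel b A B = - (-1) ^+ b *: rel b B A.
Proof.
rewrite /rel scalerBr scalerA mulNr.
by rewrite -signr_addb addbb !scaleNr opprK scale1r addrC. Qed.

Lemma rel_adj b A B : A \is hermsymmx -> B \is hermsymmx ->
  (rel b A B)^t* = rel b B A.
Proof.
move=> /hermP hA /hermP hB.
by rewrite adjD -scaleNr adjZ !adjM hA hB rmorphN /= conj_sign scaleNr.
Qed.

(** Taking the adjoint swaps the two arguments, which only changes the sign. This normality is what
    [sylvester_bound] asks for. *)
Lemma rel_normal b A B : A \is hermsymmx -> B \is hermsymmx ->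
  rel b A B \is normalmx.
Proof.
move=> hA hB; apply/normalmxP; rewrite (rel_adj b hA hB) (rel_sym b B A).
by move: (rel b A B) => M; rewrite -scalemxAr -scalemxAl.
Qed.

Lemma opbound_relC b e A B : opbound e (rel b A B) -> opbound e (rel b B A).
Proof.
move=> AB; rewrite rel_sym -[e]mul1r -(normc_sign b) -normcN.
exact: opboundZ.
Qed.

Lemma opbound_reflection s : reflection s -> opbound 1 s.
Proof. by move=> [/hermP hs ss] v; rewrite mul1r l2norm_isometry // hs. Qed.

Lemma mulmx_conj (Q P A B : 'M[R[i]]_d) : P *m Q = 1%:M ->
  (Q *m A *m P) *m (Q *m B *m P) = Q *m (A *m B) *m P.
Proof.
by move=> PQ; rewrite !mulmxA -(mulmxA (Q *m A)) PQ mulmx1.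
Qed.

Lemma spectral_conjM P x y : P *m P^t* = 1%:M ->
  (P^t* *m diag_mx x *m P) *m (P^t* *m diag_mx y *m P) =
  P^t* *m diag_mx (\row_j (x 0 j * y 0 j)) *m P.
Proof. by move=> PP; rewrite (mulmx_conj _ _ PP) mulmx_diag; reflexivity. Qed.

Lemma inner_conj P A v : inner v (P^t* *m A *m P *m v) = inner (P *m v) (A *m (P *m v)).
Proof. by rewrite -!mulmxA [LHS]inner_adj trmxCK. Qed.

Lemma inner_diag_ge (m : R) y v : (forall k, m%:C <= y 0 k) ->
  (m * l2norm v ^+ 2)%:C <= inner v (diag_mx y *m v).
Proof.
move=> my; rewrite rmorphM /= l2norm_inner /inner mul_diag_mx !mxE mulr_sumr.
apply: ler_sum => k _; rewrite !mxE [leRHS]mulrCA ler_wpM2r //.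
by rewrite mulrC mul_conjC_ge0.
Qed.

(** Functional calculus: [s] is the sign of [A] in its eigenbasis, so [s *m A] is the absolute value
    of [A], bounded below by [1 - eta]. *)
Lemma sign_rounding eta A : A \is hermsymmx -> 0 <= eta < 1 ->
    (forall a, eigenvalue A a -> 1 - eta <= Normc.normc a <= 1) ->
  exists s, [/\ reflection s, opbound eta (s - A), s *m A = A *m s
    & forall v, ((1 - eta) * l2norm v ^+ 2)%:C <= inner v (s *m A *m v)].
Proof.
move=> hA /andP[eta0 eta1] specA; have An := hermitian_normalmx hA.
pose P := spectralmx A; pose D := spectral_diag A.
have PP : P *m P^t* = 1%:M := spectralmxK_adj A.
have PP' : P^t* *m P = 1%:M := spectralmx_adjK A.
have AE : A = P^t* *m diag_mx D *m P := normal_spectralE An.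
have Dreal k : D 0 k \is Num.real.
  by have /mxOverP := hermitian_spectral_diag_real hA; apply.
have Dbnd k : 1 - eta <= Normc.normc (D 0 k) <= 1.
  exact/specA/eigenvalue_spectral_diag.
have Dn0 k : D 0 k != 0.
  apply/eqP => D0; have /andP[+ _] := Dbnd k; rewrite D0 Normc.normc0.
  by rewrite subr_le0 leNgt eta1.
clearbody P D.
pose x : 'rV_d := \row_k Num.sg (D 0 k).
have xD k : x 0 k * D 0 k = (Normc.normc (D 0 k))%:C.
  by rewrite mxE {2}(realEsg (Dreal k)) mulrA -expr2 sqr_sg Dn0 mul1r.
exists (P^t* *m diag_mx x *m P); split.
- split.
    apply/hermP; rewrite !adjM trmxCK -!mulmxA; congr (_ *m (_ *m _)).
    rewrite tr_diag_mx map_diag_mx; congr diag_mx; apply/rowP => k.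
    rewrite !mxE; apply/CrealP; rewrite /Num.sg.
    by do ?case: ifP => _; rewrite ?rpredN ?rpred0 ?rpred1.
  rewrite (spectral_conjM x x PP) (_ : diag_mx _ = 1%:M) ?mulmx1; first exact: PP'.
  rewrite -diag_const_mx; congr diag_mx; apply/rowP => k.
  by rewrite !mxE -expr2 sqr_sg Dn0.
- rewrite [X in _ - X]AE -mulmxBl -mulmxBr -linearB /=.
  apply: opbound_conj => //; apply: opbound_diag => // k.
  (* For a real nonzero eigenvalue D, sg D - D = sg D (1 - |D|), of modulus 1 - |D|. *)
  rewrite !mxE {2}(realEsg (Dreal k)) -{1}[Num.sg _]mulr1 -mulrBr Normc.normcM.
  have -> : Normc.normc (Num.sg (D 0 k)) = 1.
    by apply: complexI; rewrite -normC_normc normr_sg Dn0.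
  have /andP[D1 D2] := Dbnd k.
  rewrite mul1r normC_normc -(rmorph1 (real_complex R)) -rmorphB.
  by rewrite normc_ge0_id ?subr_ge0 // lerBlDl -lerBlDr.
- rewrite AE (spectral_conjM x D PP) (spectral_conjM D x PP).
  suff -> : \row_j (x 0 j * D 0 j) = \row_j (D 0 j * x 0 j) by [].
  by apply/rowP => k; rewrite mxE mulrC [RHS]mxE.
- move=> v; rewrite -(l2norm_isometry v PP') [X in _ *m X *m v]AE.
  rewrite (spectral_conjM x D PP) inner_conj; apply: inner_diag_ge => k.
  by rewrite mxE xD lecR; have /andP[] := Dbnd k.
Qed.

(** Since [s] commutes with [A] and squares to 1, [s A s B = A B] and [B s s A = B A]; the two
    remaining terms form the conjugate by [s]. *)
Lemma rel_sylvester b A B s : s *m s = 1%:M -> s *m A = A *m s ->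
  s *m A *m rel b s B + rel b s B *m (s *m A) =
  rel b A B + - (-1) ^+ b *: (s *m rel b A B *m s).
Proof.
move=> ss sA; have cc : (-1) ^+ b * (-1) ^+ b = 1 :> R[i].
  by rewrite -signr_addb addbb.
rewrite /rel; set c := (-1) ^+ b in cc *.
rewrite !(mulmxBr, mulmxBl) -!scalemxAr -!scalemxAl !mulmxA.
rewrite -(mulmxA B s s) ss mulmx1 -(mulmxA (s *m B) s A) sA mulmxA.
rewrite -(mulmxA A s s) ss mulmx1 scalerBr scalerA mulNr cc !scaleNr scale1r opprK.
by rewrite [s *m B *m A *m s - _]addrC addrACA.
Qed.

(** The right side of [rel_sylvester] has norm at most [2 * e]; [sylvester_bound] divides it by
    [2 * (1 - eta)]. *)
Lemma opbound_rel_rounding eta e b A B s :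
  eta < 1 -> 0 <= e -> B \is hermsymmx ->
  reflection s -> s *m A = A *m s ->
  (forall v, ((1 - eta) * l2norm v ^+ 2)%:C <= inner v (s *m A *m v)) ->
  opbound e (rel b A B) -> opbound (e / (1 - eta)) (rel b s B).
Proof.
move=> eta1 e0 hB rs sA sApos ABe; have [hs ss] := rs.
have eta1' : 1 - eta != 0 by rewrite subr_eq0 gt_eqF.
have -> : e / (1 - eta) = (2 * e) / (2 * (1 - eta)) by field.
apply: sylvester_bound sApos _; rewrite ?subr_gt0 ?mulr_ge0 ?rel_normal //.
rewrite (rel_sylvester b B ss sA) mulr_natl mulr2n; apply: (opboundD ABe).
rewrite -[e]mul1r -(normc_sign b) -normcN; apply: opboundZ.
have s1 := opbound_reflection rs.
rewrite -[X in opbound X]mulr1; apply: (opboundM e0 _ s1).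
by rewrite -[e]mul1r; apply: (opboundM ler01 s1 ABe).
Qed.
End Rounding.

(** * Averaging over conjugation by a reflection *)

Section Twirl.
Variables (R : realType) (d : nat).
Implicit Types (v w : 'cV[R[i]]_d) (A B T U M N s : 'M[R[i]]_d) (b t u : bool).

Lemma relDl b A B U : rel b (A + B) U = rel b A U + rel b B U.
Proof. by rewrite /rel mulmxDl mulmxDr scalerDr opprD addrACA. Qed.

Lemma relDr b A B U : rel b U (A + B) = rel b U A + rel b U B.
Proof. by rewrite /rel mulmxDl mulmxDr scalerDr opprD addrACA. Qed.

Lemma relZl b a A B : rel b (a *: A) B = a *: rel b A B.
Proof.
by rewrite /rel -scalemxAl -scalemxAr scalerBr !scalerA (mulrC a).
Qed.

Lemma relZr b a A B : rel b A (a *: B) = a *: rel b A B.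
Proof.
by rewrite /rel -scalemxAl -scalemxAr scalerBr !scalerA (mulrC a).
Qed.

Lemma rel_conj b s A B : s *m s = 1%:M ->
  s *m rel b A B *m s = rel b (s *m A *m s) (s *m B *m s).
Proof.
move=> ss; rewrite /rel mulmxBr mulmxBl -scalemxAr -scalemxAl.
by rewrite !(mulmx_conj _ _ ss).
Qed.

Lemma opbound_rel b e f A B : 0 <= e -> 0 <= f -> opbound e A -> opbound f B ->
  opbound (2 * (e * f)) (rel b A B).
Proof.
move=> e0 f0 Ae Bf; rewrite mulr_natl mulr2n; apply: opboundD.
  exact: opboundM.
rewrite -scaleNr -[X in opbound X]mul1r -(normc_sign R b) -normcN.
by apply: opboundZ; rewrite mulrC; exact: opboundM.
Qed.

(** The projection onto the operators that commute ([t = false]) or anticommute ([t = true]) with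
    the reflection [s]. *)
Definition twirl t s T : 'M[R[i]]_d := 2^-1 *: (T + (-1) ^+ t *: (s *m T *m s)).

Lemma twirl_herm t s T : reflection s -> reflection T -> twirl t s T \is hermsymmx.
Proof.
move=> [/hermP hs _] [/hermP hT _]; apply/hermP.
by rewrite adjZ adjD adjZ !adjM hs hT mulmxA conj_sign fmorphV rmorph_nat.
Qed.

Lemma sub_twirl t s T :
  T - twirl t s T = 2^-1 *: (T - (-1) ^+ t *: (s *m T *m s)).
Proof.
rewrite /twirl; apply/matrixP => i j; move: (s *m T *m s) => V; rewrite !mxE.
by field.
Qed.

Lemma conj_twirl t s T : s *m s = 1%:M ->
  s *m twirl t s T *m s = (-1) ^+ t *: twirl t s T.
Proof.
move=> ss; rewrite /twirl -scalemxAr -scalemxAl mulmxDr mulmxDl scalerA mulrC.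
rewrite -scalerA; congr (_ *: _).
rewrite -scalemxAr -scalemxAl !mulmxA ss mul1mx -(mulmxA _ s s) ss mulmx1.
by rewrite scalerDr scalerA -signr_addb addbb scale1r addrC.
Qed.

Lemma conj_sub_twirl t s T : s *m s = 1%:M ->
  s *m (T - twirl t s T) *m s = - (-1) ^+ t *: (T - twirl t s T).
Proof.
move=> ss; rewrite mulmxBr mulmxBl (conj_twirl t T ss) /twirl.
move: (s *m T *m s) => V; apply/matrixP => i j; rewrite !mxE.
by case: t; rewrite ?expr0 ?expr1; field.
Qed.

(** The discarded part is exactly half of [s *m rel t s T], because [s] squares to 1. *)
Lemma opbound_sub_twirl t s T e : reflection s -> opbound e (rel t s T) ->
  opbound (e / 2) (T - twirl t s T).
Proof.
move=> rs Te; rewrite sub_twirl.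
have -> : T - (-1) ^+ t *: (s *m T *m s) = s *m rel t s T.
  have [_ ss] := rs.
  by rewrite /rel mulmxBr -scalemxAr !mulmxA ss mul1mx.
rewrite mulrC -[X in X * e](@normc_ge0_id R) ?invr_ge0 // fmorphV rmorph_nat.
rewrite -[X in opbound (_ * X)]mul1r; apply: opboundZ.
exact: (opboundM ler01 (opbound_reflection rs) Te).
Qed.

Lemma rel_twirl_pivot t s T : s *m s = 1%:M -> rel t s (twirl t s T) = 0.
Proof.
move=> ss; have := conj_twirl t T ss; move: (twirl t s T) => P sP.
rewrite /rel; have -> : s *m P = s *m P *m s *m s.
  by rewrite -(mulmxA _ s s) ss mulmx1.
by rewrite sP -scalemxAl subrr.
Qed.

Lemma twirl_self s : s *m s = 1%:M -> twirl false s s = s.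
Proof.
move=> ss; rewrite /twirl ss mul1mx expr0; apply/matrixP => i j; rewrite !mxE.
by field.
Qed.

(* Conjugation by [s] grades the operators, and mixed terms change the grade of
   [rel b T U], so averaging over the conjugation removes them. *)
Lemma rel_twirl b t u s T U : s *m s = 1%:M ->
  rel b (twirl t s T) (twirl u s U) =
  2^-1 *: (rel b T U + (-1) ^+ (t (+) u) *: (s *m rel b T U *m s))
  + - 1 *: rel b (T - twirl t s T) (U - twirl u s U).
Proof.
move=> ss; rewrite (rel_conj b T U ss).
have sT := conj_twirl t T ss; have sU := conj_twirl u U ss.
have sT' := conj_sub_twirl t T ss; have sU' := conj_sub_twirl u U ss.
have TE : T = twirl t s T + (T - twirl t s T) by rewrite addrC subrK.
have UE : U = twirl u s U + (U - twirl u s U) by rewrite addrC subrK.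
move: (twirl t s T) (T - twirl t s T) (twirl u s U) (U - twirl u s U)
  TE UE sT sU sT' sU' => P M Q N -> -> sP sQ sM sN.
rewrite !(mulmxDr, mulmxDl) sP sQ sM sN !(relDl, relDr) !(relZl, relZr).
move: (rel b P Q) (rel b P N) (rel b M Q) (rel b M N) => a1 a2 a3 a4.
apply/matrixP => i j; rewrite !mxE.
by case: t sP sM => _ _; case: u sQ sN => _ _; rewrite /= ?expr0 ?expr1; field.
Qed.

(** In [rel_twirl] the average contributes at most [g], and the relation of the two discarded parts
    at most [2 * (e / 2) * (f / 2)]. *)
Lemma opbound_rel_twirl b t u s T U e f g :
  reflection s -> 0 <= e -> 0 <= f -> 0 <= g ->
  opbound e (rel t s T) -> opbound f (rel u s U) -> opbound g (rel b T U) ->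
  opbound (g + e * f / 2) (rel b (twirl t s T) (twirl u s U)).
Proof.
move=> rs e0 f0 g0 Te Uf TUg; have [_ ss] := rs.
rewrite (rel_twirl b t u T U ss); apply: opboundD.
  have -> : g = Normc.normc (2^-1 : R[i]) * (g + g).
    rewrite -(rmorph_nat (real_complex R)) -fmorphV normc_ge0_id ?invr_ge0 //.
    by field.
  apply: opboundZ; apply: (opboundD TUg).
  rewrite -[X in opbound X]mul1r -(normc_sign R (t (+) u)); apply: opboundZ.
  have s1 := opbound_reflection rs.
  rewrite -[X in opbound X]mulr1; apply: (opboundM g0 _ s1).
  by rewrite -[X in opbound X]mul1r; apply: (opboundM ler01 s1 TUg).
have -> : e * f / 2 = Normc.normc (- 1 : R[i]) * (2 * (e / 2 * (f / 2))).
  by rewrite normcN Normc.normc1; field.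
have e2 : 0 <= e / 2 by rewrite divr_ge0.
have f2 : 0 <= f / 2 by rewrite divr_ge0.
apply: opboundZ.
exact: (opbound_rel b e2 f2 (opbound_sub_twirl rs Te) (opbound_sub_twirl rs Uf)).
Qed.

(** The cross terms [T U] and [U T] cancel, as in the parallelogram law. *)
Lemma half_sum_diff_sqr T U : T *m T = 1%:M -> U *m U = 1%:M ->
  (2^-1 *: (T + U)) *m (2^-1 *: (T + U)) +
  (2^-1 *: (T - U)) *m (2^-1 *: (T - U)) = 1%:M.
Proof.
move=> TT UU; have hmul A : (2^-1 *: A) *m (2^-1 *: A) = 4^-1 *: (A *m A).
  by rewrite -scalemxAl -scalemxAr scalerA; congr (_ *: _); field.
rewrite !hmul !mulmxDl !mulmxDr !mulNmx !mulmxN opprK TT UU.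
move: (T *m U) (U *m T) => X Y; apply/matrixP => i j; rewrite !mxE.
by field.
Qed.

Lemma twirl_sqr t s T : reflection s -> reflection T ->
  twirl t s T *m twirl t s T + (T - twirl t s T) *m (T - twirl t s T) = 1%:M.
Proof.
move=> [_ ss] [_ TT]; rewrite sub_twirl /twirl; apply: (half_sum_diff_sqr TT).
rewrite -scalemxAl -scalemxAr (mulmx_conj _ _ ss) TT mulmx1 ss scalerA.
by rewrite -signr_addb addbb scale1r.
Qed.

(** With P the kept and M the discarded part, [P^2 + M^2 = 1], so a unit eigenvector w of P
    satisfies [|a|^2 = 1 - |M w|^2], where [|M w| <= e / 2]. *)
Lemma eigenvalue_twirl t s T e a : reflection s -> reflection T ->
  0 <= e -> opbound e (rel t s T) -> eigenvalue (twirl t s T) a ->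
  1 - e ^+ 2 / 4 <= Normc.normc a <= 1.
Proof.
move=> rs rT e0 Te /eigenvalueP [v va v0].
have hP := twirl_herm t rs rT; have Me := opbound_sub_twirl rs Te.
have hM : T - twirl t s T \is hermsymmx.
  have [/hermP hT _] := rT; apply/hermP.
  by move/hermP: hP => hP; rewrite adjD -scaleN1r adjZ hP rmorphN rmorph1 hT.
have PM := twirl_sqr t rs rT.
move: (twirl t s T) (T - twirl t s T) va hP hM PM Me => P M va /hermP hP /hermP hM PM Me.
pose w := v^t*.
(* The row eigenvector becomes a column eigenvector by taking adjoints, with conjugate eigenvalue of
   the same modulus. *)
have Pw : P *m w = (a^*)%R *: w by rewrite -[P]hP -adjM va adjZ.
have w0 : 0 < l2norm w.
  rewrite lt_neqAle l2norm_ge0 andbT eq_sym; apply: contra_neq v0 => /l2norm_eq0 w0.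
  by rewrite -[LHS]trmxCK -/w w0 trmx0 map_mx0.
have := Me w; have := l2norm_ge0 (M *m w).
have na : Normc.normc (a^*)%R = Normc.normc a.
  by apply: complexI; rewrite -!normC_normc norm_conjC.
have : l2norm (P *m w) ^+ 2 + l2norm (M *m w) ^+ 2 = l2norm w ^+ 2.
  apply: complexI; rewrite rmorphD /= !l2norm_inner !inner_adj hP hM !mulmxA.
  by rewrite -innerDl -mulmxDl PM mul1mx.
rewrite {}Pw l2normZ na; move: (normc_ge0 a) (l2norm w) w0 (l2norm (M *m w)).
move: (Normc.normc a) => x x0 y y0 z xyz z0 zy.
have x1 : x <= 1.
  rewrite -(ler_pM2r y0) mul1r -ler_sqr ?nnegrE ?mulr_ge0 // ?(ltW y0) //.
  by rewrite -xyz lerDl sqr_ge0.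
(* As [|a| <= 1], a lower bound on [|a|^2] is one on [|a|]. *)
rewrite x1 andbT; apply: (@le_trans _ _ (x ^+ 2)); last first.
  by rewrite expr2 ler_piMl.
rewrite -(ler_pM2r (exprn_gt0 2 y0)) -exprMn mulrBl mul1r lerBlDr -[leLHS]xyz lerD2l.
have -> : e ^+ 2 / 4 * y ^+ 2 = (e / 2 * y) ^+ 2 by field.
by rewrite ler_sqr ?nnegrE // mulr_ge0 ?divr_ge0 // ltW.
Qed.

End Twirl.

(** * Correcting a family of reflections one pivot at a time *)

Section Families.
Variables (R : realType) (d : nat) (I : eqType) (chi : I -> I -> bool).
Hypothesis chi_sym : forall i j, chi i j = chi j i.
Hypothesis chi_refl : forall i, chi i i = false.
Implicit Types (T U : I -> 'M[R[i]]_d) (e : R).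

(** [chi i j] tells whether the pair should anticommute ([true]) or commute ([false]). *)
Definition near_rel e T := forall i j, opbound e (rel (chi i j) (T i) (T j)).

Definition exact_rel T q := forall i, rel (chi q i) (T q) (T i) = 0.

(** The members of a pair are rounded one after the other, each at the cost of a factor
    [1 / (1 - eta)]. Leaving [e] and [b] free allows [e = 0]: exact relations survive rounding. *)
Lemma round_family eta (A : I -> 'M[R[i]]_d) : 0 <= eta < 1 ->
    (forall i, A i \is hermsymmx) ->
    (forall i a, eigenvalue (A i) a -> 1 - eta <= Normc.normc a <= 1) ->
  exists T, [/\ forall i, reflection (T i), forall i, opbound eta (T i - A i)
    & forall e i j b, 0 <= e ->
        opbound e (rel b (A i) (A j)) ->
        opbound (e / (1 - eta) ^+ 2) (rel b (T i) (T j))].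
Proof.
move=> eta01 hA specA; have /andP[eta0 eta1] := eta01.
have [T TP] := choice (fun i => sign_rounding (hA i) eta01 (specA i)).
exists T; split=> [i|i|e i j b e0 Aij].
- by case: (TP i).
- by case: (TP i).
have [ri _ ci pi] := TP i; have [rj _ cj pj] := TP j.
have eta1' : 0 < 1 - eta by rewrite subr_gt0.
have e1 : 0 <= e / (1 - eta) by rewrite divr_ge0 // ltW.
have TiA := opbound_rel_rounding eta1 e0 (hA j) ri ci pi Aij.
have AjT := opbound_rel_rounding eta1 e1 ri.1 rj cj pj (opbound_relC TiA).
have -> : e / (1 - eta) ^+ 2 = e / (1 - eta) / (1 - eta).
  by rewrite expr2 invfM mulrA.
exact: opbound_relC AjT.
Qed.

(** Twirl every operator by the pivot [T p], then round the results, whose spectrum is within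
    [e ^+ 2 / 4] of 1 in modulus. *)
Lemma pivot_step T e p :
    0 <= e <= 1 / 16 -> (forall i, reflection (T i)) -> near_rel e T ->
  exists T', [/\ forall i, reflection (T' i), near_rel (e + e ^+ 2) T',
    forall i, opbound e (T' i - T i), exact_rel T' p
    & forall q, exact_rel T q -> exact_rel T' q].
Proof.
move=> /andP[e0 e32] rT Te; pose A i := twirl (chi p i) (T p) (T i).
have hA i : A i \is hermsymmx by apply: twirl_herm.
have eta01 : 0 <= e ^+ 2 / 4 < 1 by apply/andP; split; nra.
have specA i a : eigenvalue (A i) a -> 1 - e ^+ 2 / 4 <= Normc.normc a <= 1.
  by move=> Aa; exact: (eigenvalue_twirl (rT p) (rT i) e0 (Te p i) Aa).
have [T' [rT' T'A relT']] := round_family eta01 hA specA.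
have exact_of i j b : rel b (A i) (A j) = 0 -> rel b (T' i) (T' j) = 0.
  move=> Aij; apply: opbound_eq0.
  have := relT' 0 i j b (lexx 0); rewrite Aij mul0r; apply; exact: opbound0.
have ss := (rT p).2.
exists T'; split; first exact: rT'.
- move=> i j.
  have := opbound_rel_twirl (rT p) e0 e0 e0 (Te p i) (Te p j) (Te i j).
  move=> /(relT' _ i j (chi i j)) h; apply: opbound_le (h _); last by nra.
  have /andP[_ e4] := eta01.
  (* Uses [(1 - e^2/4)^2 >= 1 - e^2/2]; the gain [e^2/2] of the bound [e + e^2] over [e + e^2/2]
     absorbs this loss. *)
  rewrite ler_pdivrMr ?exprn_gt0 ?subr_gt0 //.
  have ee : e + e * e / 2 <= (e + e ^+ 2) * (1 - e ^+ 2 / 2).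
    suff : 0 <= e * e * (1 - e - e ^+ 2) by lra.
    by rewrite mulr_ge0 ?mulr_ge0 //; nra.
  apply: le_trans ee _; rewrite ler_wpM2l ?addr_ge0 ?sqr_ge0 //.
  by have := sqr_ge0 (e ^+ 2 / 4); lra.
(* Rounding moves by at most [e^2/4] and twirling by at most [e/2], together at most [e]. *)
- move=> i; have := opboundD (T'A i) (opboundN (opbound_sub_twirl (rT p) (Te p i))).
  rewrite -/(A i) opprB addrA subrK.
  apply: opbound_le; nra.
(* The pivot commutes with itself, so its own twirl leaves it unchanged. *)
- move=> i; apply: exact_of; rewrite /A chi_refl (twirl_self ss).
  exact: rel_twirl_pivot.
move=> q Tq i; apply: exact_of.
(* The relation between [q] and the pivot is already exact, so twirling discards nothing from [T q]
   and the error product vanishes. *)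
have T0 : opbound 0 (rel (chi p q) (T p) (T q)).
  by apply: opbound_relC; rewrite chi_sym Tq; exact: opbound0.
have Tqi : opbound 0 (rel (chi q i) (T q) (T i)) by rewrite Tq; exact: opbound0.
have := opbound_rel_twirl (rT p) (lexx 0) e0 (lexx 0) T0 (Te p i) Tqi.
by rewrite mul0r mul0r addr0 => /opbound_eq0.
Qed.

(** Induction on the pivots: while the error stays below [2 * e0], each step adds at most [4 * e0^2]
    to it and moves each operator by at most [2 * e0]. *)
Lemma exact_family (ps : seq I) T e0 : 0 <= e0 ->
    64 * (size ps)%:R * e0 <= 2 -> (forall i, reflection (T i)) -> near_rel e0 T ->
  exists T', [/\ forall i, reflection (T' i),
    near_rel (e0 + 4 * (size ps)%:R * e0 ^+ 2) T',
    forall i, opbound (2 * (size ps)%:R * e0) (T' i - T i)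
    & forall q, q \in ps -> exact_rel T' q].
Proof.
move=> e00 ps_le rT Te; elim: ps ps_le => [|p ps IH] /= ps_le.
  exists T; split=> // [|i]; first by rewrite mulr0 mul0r addr0.
  by rewrite mulr0 mul0r subrr; exact: opbound0.
set k := (size ps)%:R : R; have k0 : 0 <= k by exact: ler0n.
rewrite -natr1 -/k in ps_le *.
have {IH} [|T' [rT' T'e T'T exT']] := IH; first by nra.
have ek : e0 + 4 * k * e0 ^+ 2 <= 2 * e0 by nra.
have ek0 : 0 <= e0 + 4 * k * e0 ^+ 2 by rewrite addr_ge0 ?mulr_ge0 ?sqr_ge0.
(* The size condition forces [e0 <= 1/32], so the current error is at most [1/16], as [pivot_step]
   requires. *)
have [|T2 [rT2 T2e T2T' exT2 pres]] := pivot_step p _ rT' T'e.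
  by rewrite ek0 /=; nra.
exists T2; split; first exact: rT2.
- move=> i j; apply: opbound_le (T2e i j); nra.
- move=> i; have := opboundD (T2T' i) (T'T i).
  rewrite addrA subrK; apply: opbound_le; nra.
move=> q; rewrite in_cons => /orP[/eqP -> //|qps]; exact/pres/exT'.
Qed.

End Families.

(** * Indexing the operators by letter and site, and the final assembly *)

Section Qubits.
Variables (R : realType) (n d : nat).

Lemma rel_commutator (A B : 'M[R[i]]_d) : rel false A B = commutator A B.
Proof. by rewrite /rel scale1r. Qed.

Lemma rel_anticommutator (A B : 'M[R[i]]_d) : rel true A B = anticommutator A B.
Proof. by rewrite /rel expr1 scaleN1r opprK. Qed.

Lemma spectrum_near_pm1_normc eps (A : 'M[R[i]]_d) a : eps < 1 ->
  spectrum_near_pm1 eps A -> eigenvalue A a -> 1 - eps <= Normc.normc a <= 1.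
Proof.
move=> eps1 specA /specA {specA}; rewrite -!lecR -normC_normc rmorphB rmorph1 /=.
have e1 : 0 <= 1 - eps%:C.
  by rewrite -(rmorph1 (real_complex R)) -rmorphB ler0c subr_ge0 ltW.
case=> /andP[a1 a2].
  have a0 : a <= 0 by apply: le_trans a2 _; rewrite -oppr_ge0 opprD opprK.
  by rewrite ler0_norm // lerNl a1 andbT lerNr opprB addrC.
by rewrite ger0_norm ?a1 ?a2 // (le_trans e1 a1).
Qed.

(** Booleans code the letters so that the pairs of letter and site form a finite type to enumerate
    as pivots. *)
Definition letter_of (b : bool) : letter := if b then X else Z.

Definition anticommuting_pair (p q : bool * 'I_n) : bool :=
  (p.2 == q.2) && (p.1 != q.1).

End Qubits.

Theorem theorem3p6 (R : realType) (n d : nat) (eps : R)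
    (A : letter -> 'I_n -> 'M[R[i]]_d) :
  (1 <= n)%N ->
  0 <= eps < 1 ->
  eps / (1 - eps) ^+ 2 <= 1 / (64 * n%:R) ->
  (forall (S : letter) (j : 'I_n), A S j \is hermsymmx) ->
  (forall (S : letter) (j : 'I_n), spectrum_near_pm1 eps (A S j)) ->
  (forall j : 'I_n, opnorm (anticommutator (A X j) (A Z j)) <= eps) ->
  (forall (S T : letter) (i j : 'I_n), i <> j ->
     opnorm (commutator (A S i) (A T j)) <= eps) ->
  exists A' : letter -> 'I_n -> 'M[R[i]]_d,
    [/\ forall (S : letter) (j : 'I_n), reflection (A' S j),
        forall j : 'I_n, anticommutator (A' X j) (A' Z j) = 0,
        forall (S T : letter) (i j : 'I_n), i <> j ->
          commutator (A' S i) (A' T j) = 0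
      & forall (S : letter) (j : 'I_n),
          opnorm (A' S j - A S j) <= 4 * n%:R * eps / (1 - eps) ^+ 2 + eps].
Proof.
move=> n1 eps01 small hA specA antiA commA; have /andP[eps0 eps1] := eps01.
have normA S j a (Aa : eigenvalue (A S j) a) :=
  spectrum_near_pm1_normc eps1 (@specA S j) Aa.
have A1 S j : opbound 1 (A S j).
  have An := hermitian_normalmx (hA S j).
  apply: opbound_normal => // i.
  by have /andP[] := normA S j _ (eigenvalue_spectral_diag i An).
(* Each operator has norm at most 1, which supplies the a priori bound 2 on every relation needed to
   exploit [opnorm]. *)
have relA b S T i j : opnorm (rel b (A S i) (A T j)) <= eps ->
    opbound eps (rel b (A S i) (A T j)).
  apply: opnorm_opbound (opbound_rel b ler01 ler01 (A1 S i) (A1 T j)).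
  by rewrite !mulr1.
pose B (p : bool * 'I_n) := A (letter_of p.1) p.2.
have nearB p q : opbound eps (rel (anticommuting_pair p q) (B p) (B q)).
  case: p q => [a i] [b j]; rewrite /anticommuting_pair /B /=.
  have [<-{j}|ij] := eqVneq i j; last first.
    by apply: relA; rewrite rel_commutator; apply: commA; exact/eqP.
  have antiXZ : opbound eps (rel true (A X i) (A Z i)).
    by apply: relA; rewrite rel_anticommutator.
  have self_comm S : opbound eps (rel false (A S i) (A S i)).
    rewrite rel_commutator /commutator subrr.
    exact: opbound_le eps0 (@opbound0 R d).
  case: a; case: b => /=; first exact: self_comm.
  - exact: antiXZ.
  - exact: opbound_relC antiXZ.
  exact: self_comm.
have [T [rT TB relT]] := round_family eps01 (fun p => hA (letter_of p.1) p.2)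
  (fun p => normA (letter_of p.1) p.2).
(* The error after the initial rounding, with one factor [1 - eps] for each member of a pair. *)
set e0 := eps / (1 - eps) ^+ 2 in small *.
have e0_ge0 : 0 <= e0 by rewrite divr_ge0 // sqr_ge0.
have nearT : near_rel (@anticommuting_pair n) e0 T.
  by move=> p q; exact: (relT eps p q _ eps0 (nearB p q)).
have chi_sym p q : @anticommuting_pair n p q = anticommuting_pair q p.
  by rewrite /anticommuting_pair eq_sym [_.1 == _]eq_sym.
have chi_refl p : @anticommuting_pair n p p = false.
  by rewrite /anticommuting_pair eqxx eqxx.
have size_enum : size (enum {: bool * 'I_n}) = (2 * n)%N.
  by rewrite -cardE card_prod card_bool card_ord.
have n_gt0 : 0 < n%:R :> R by rewrite ltr0n.
(* There are [2 * n] pivots, so [64 * n * e0 <= 1] becomes the bound by 2. *)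
have small' : 64 * (size (enum {: bool * 'I_n}))%:R * e0 <= 2.
  rewrite size_enum natrM; move: small; rewrite ler_pdivlMr ?mulr_gt0 //; lra.
have [T' [rT' _ T'T exT']] := exact_family chi_sym chi_refl e0_ge0 small' rT nearT.
pose letter_bool S := if S is X then true else false.
exists (fun S j => T' (letter_bool S, j)); split.
- by move=> S j; exact: rT'.
- move=> j; have := exT' (true, j) (mem_enum _ _) (false, j).
  by rewrite /anticommuting_pair /= eqxx rel_anticommutator.
- move=> S U i j /eqP ij.
  have := exT' (letter_bool S, i) (mem_enum _ _) (letter_bool U, j).
  by rewrite /anticommuting_pair /= (negPf ij) rel_commutator.
move=> S j; apply: opbound_opnorm.
  by rewrite addr_ge0 // divr_ge0 ?sqr_ge0 // !mulr_ge0 // ler0n.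
(* The [2 * n] pivot steps move each operator by at most [2 * (2 * n) * e0], and the initial
   rounding by at most [eps]. *)
have := opboundD (T'T (letter_bool S, j)) (TB (letter_bool S, j)).
rewrite addrA subrK (_ : letter_of (letter_bool S, j).1 = S); last by case: S.
apply: opbound_le; rewrite lerD2r size_enum natrM mulrA -natrM -mulrA.
by rewrite -!mulrA lexx.
Qed.
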